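(* Let $\alpha_1,\ldots,\alpha_r$ be positive integers. Then there exist distinct primes $p_1<\cdots<p_r$ such that $p_1^{\alpha_1}\cdots p_r^{\alpha_r}$ is a covering number if and only if one of the following holds: (i) $r=2$ and $\alpha_1\geqslant 2$; (ii) $r=3$ and $\max\{\alpha_1,\alpha_2\}\geqslant 2$; (iii) $r\geqslant 4$.
   Context: For $a\in\mathbb{Z}$ and a positive integer $n$, $a(\mathrm{mod}\ n)=\{a+nx: x\in\mathbb{Z}\}$ is the residue class with modulus $n$. A finite system of residue classes $\{a_i(\mathrm{mod}\ n_i)\}_{i=1}^k$ is a cover of $\mathbb{Z}$ if every integer lies in at least one of the classes $a_i(\mathrm{mod}\ n_i)$. A positive integer $n$ is called a covering number if there is a cover of $\mathbb{Z}$ whose moduli are all distinct, greater than one, and divisors of $n$. *)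

(* Defs.v *)
From HB Require Import structures.
From mathcomp Require Import all_boot all_order all_algebra.

Set Implicit Arguments.
Unset Strict Implicit.
Unset Printing Implicit Defensive.

Import GRing.Theory.

Definition residue_class (a : int) (n : nat) (x : int) : Prop :=
  exists y : int, x = (a + n%:Z * y)%R.

(* A pair (a, n) in the list s stands for the class a (mod n).  Positivity of
   the moduli is not part of this definition: it follows from 1 < n in
   covering_number. *)
Definition is_cover (s : seq (int * nat)) : Prop :=
  forall x : int, exists2 c, c \in s & residue_class c.1 c.2 x.

Definition covering_number (n : nat) : Prop :=
  0 < n /\
  exists s : seq (int * nat),
    [/\ is_cover s,
        uniq [seq c.2 | c <- s],
        forall c, c \in s -> 1 < c.2
      & forall c, c \in s -> c.2 %| n].

(* Main.v *)
(* Necessity: build an uncovered integer one prime at a time.  A class of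
   integers mod M that avoids every modulus dividing M splits into q classes
   mod M q, and each new modulus (one dividing M q but not M) meets at most one
   of them; so some class mod M q survives as soon as there are fewer than q new
   moduli.  For M = m q^j with m prime to q, the new moduli are the d q^(j+1)
   with d | m.  As the number of divisors of m is 1, 2, 4 for m = 1, p, p p',
   this excludes q^c, p q^c (p < q) and p p' q^c (p < p' < q).
   Sufficiency: 12, 90 and 210 are covering numbers, and so is every multiple of
   a covering number. *)
Require Import Defs.
From mathcomp Require Import all_boot all_order all_algebra.
From mathcomp Require Import ring zify.

Import GRing.Theory Num.Theory.

(** * Escaping integers and the step from [M] to [M * q] *)

Lemma residue_classP (a : int) (n : nat) (x : int) :
  reflect (residue_class a n x) (n%:Z %| (x - a)%R)%Z.
Proof.
apply: (iffP dvdzP) => -[y xE]; exists y.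
  by rewrite mulrC -xE addrC subrK.
by rewrite xE mulrC addrC addKr.
Qed.

(* The divisibility condition [c.2 %| M] makes this property depend on [x] only
   modulo [M]. *)
Definition escapes (s : seq (int * nat)) (M : nat) (x : int) : Prop :=
  forall c, c \in s -> c.2 %| M -> ~ residue_class c.1 c.2 x.

(** The system [s] is arbitrary and moduli not dividing [M] are ignored, so one and the same [s]
    serves at every stage of the induction on [M]. *)
Definition uncoverable (M : nat) : Prop :=
  forall s : seq (int * nat), uniq [seq c.2 | c <- s] ->
    (forall c, c \in s -> 1 < c.2) -> exists x, escapes s M x.

Lemma uncoverable_not_covering (M : nat) :
  uncoverable M -> ~ covering_number M.
Proof.
move=> holeM [_ [s [cov us s1 sM]]].
have [x hx] := holeM s us s1; have [c cs xc] := cov x.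
exact: hx cs (sM c cs) xc.
Qed.

Lemma uncoverable1 : uncoverable 1.
Proof.
move=> s _ s1; exists 0%R => c /s1 c1; rewrite dvdn1 => /eqP c2.
by rewrite c2 in c1.
Qed.

(** As [0 < v - u < q], the difference is prime to [q], so the gcd of [M * q] and [M * (v - u)] is
    [M]. *)
Lemma dvdn_mul_sub (n M q u v : nat) :
  prime q -> n %| M * q -> u < v < q -> n %| M * (v - u) -> n %| M.
Proof.
move=> q_pr nMq /andP[uv vq] nMuv.
have /eqP cop : coprime q (v - u).
  rewrite prime_coprime // gtnNdvd ?subn_gt0 //.
  by apply: leq_ltn_trans vq; rewrite leq_subr.
by rewrite -(muln1 M) -cop muln_gcdr dvdn_gcd nMq nMuv.
Qed.

Lemma uncoverable_step (M q : nat) :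
  0 < M -> prime q ->
  size [seq d <- divisors (M * q) | ~~ (d %| M)] < q ->
  uncoverable M -> uncoverable (M * q).
Proof.
move=> M_gt0 q_pr few holeM s us s1; have [x hx] := holeM s us s1.
have Mq_gt0 : 0 < M * q by rewrite muln_gt0 M_gt0 prime_gt0.
(* The [q] lifts of [x] modulo [M] to classes modulo [M * q]; a lift not hit by any class of [s]
   escapes. *)
pose y (u : 'I_q) : int := (x + M%:Z * (u : nat)%:Z)%R.
pose hit (u : 'I_q) (c : int * nat) :=
  (c.2 %| M * q) && (c.2%:Z %| (y u - c.1)%R)%Z.
have [/existsP[u /hasPn uP]|] := boolP [exists u, ~~ has (hit u) s].
  exists (y u) => c cs cM /residue_classP xc.
  by have := uP c cs; rewrite /hit cM xc.
rewrite negb_exists => /forallP allhit; exfalso.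
have hitP u : has (hit u) s by have := allhit u; rewrite negbK.
(* The first class hitting [y u]; the search succeeds, so the default is never reached. *)
pose c u := nth (0%R, 0) s (find (hit u) s).
have cs u : c u \in s by rewrite mem_nth // -has_find.
have /(_ _) /andP cP u : hit u (c u) by apply: nth_find.
have new u : ~~ ((c u).2 %| M).
  apply/negP => cM; have [_ xc] := cP u.
  apply: (hx _ (cs u) cM); apply/residue_classP.
  have -> : (x - (c u).1 = (y u - (c u).1) - M%:Z * (u : nat)%:Z)%R.
    by rewrite /y; ring.
  by rewrite rpredB // dvdz_mulr.
(* Equal moduli would mean the same class, since moduli in [s] are distinct. It would contain two
   lifts, so its modulus would divide [M * (v - u)] and hence [M], against [new]. *)
have far (u v : 'I_q) : u < v -> (c u).2 <> (c v).2.
  move=> uv ecuv.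
  have ec : c u = c v.
    apply/eqP; rewrite /c nth_uniq ?(map_uniq us) -?has_find //.
    rewrite -(nth_uniq 0 _ _ us) ?size_map -?has_find //.
    by rewrite !(nth_map (0%R, 0)) -?has_find // -/(c u) -/(c v) ecuv.
  have [cMq xu] := cP u; have [_ xv] := cP v; rewrite -ec in xv.
  have /negP[] := new u.
  apply: (@dvdn_mul_sub _ _ _ u v q_pr cMq); first by rewrite uv ltn_ord.
  suff : ((c u).2%:Z %| (M * (v - u))%N%:Z)%Z by [].
  have -> : ((M * (v - u))%N%:Z = (y v - (c u).1) - (y u - (c u).1))%R.
    by rewrite /y PoszM -subzn ?(ltnW uv) //; ring.
  by rewrite rpredB.
have c_inj : injective (fun u => (c u).2).
  by move=> u v /= ecuv; apply: val_inj; case: (ltngtP u v) => // /far; rewrite ecuv.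
(* The lifts inject into the new divisors, which are fewer than [q]. *)
suff : q <= size [seq d <- divisors (M * q) | ~~ (d %| M)] by rewrite leqNgt few.
rewrite -{1}(size_enum_ord q) -(size_map (fun u => (c u).2)).
apply: uniq_leq_size; first by rewrite map_inj_uniq ?enum_uniq.
move=> _ /mapP[u _ ->]; rewrite mem_filter new -dvdn_divisors //.
by case: (cP u).
Qed.

(** * Counting divisors *)

(** A new divisor has exponent of [q] exactly [j.+1], so it is determined by its part prime to [q],
    a divisor of [m]. *)
Lemma size_new_divisors (m q j : nat) :
  0 < m -> prime q -> coprime m q ->
  size [seq d <- divisors (m * q ^ j * q) | ~~ (d %| m * q ^ j)]
    <= size (divisors m).
Proof.
move=> m_gt0 q_pr mq; have q_gt0 := prime_gt0 q_pr.
rewrite -(size_map (fun d => d * q ^ j.+1) (divisors m)).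
apply: uniq_leq_size => [|d]; first by rewrite filter_uniq ?divisors_uniq.
rewrite mem_filter -mulnA -expnSr -dvdn_divisors ?muln_gt0 ?m_gt0 ?expn_gt0 ?q_gt0 //.
move=> /andP[ndvd dvd].
have d_gt0 : 0 < d.
  by apply: dvdn_gt0 dvd; rewrite muln_gt0 m_gt0 expn_gt0 q_gt0.
have [d' qd' dE] := pfactor_coprime q_pr d_gt0.
have d'm : d' %| m.
  rewrite -(@Gauss_dvdl _ _ (q ^ j.+1)); last by rewrite coprimeXr // coprime_sym.
  by apply: dvdn_trans dvd; rewrite dE dvdn_mulr.
have kj1 : logn q d <= j.+1.
  rewrite -(dvdn_Pexp2l _ _ (prime_gt1 q_pr)).
  rewrite -(@Gauss_dvdr _ m); last by rewrite coprimeXl // coprime_sym.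
  by apply: dvdn_trans dvd; rewrite {2}dE dvdn_mull.
have kj : j < logn q d.
  rewrite ltnNge; apply: contra ndvd => kj.
  by rewrite dE dvdn_mul // dvdn_exp2l.
apply/mapP; exists d'; first by rewrite -dvdn_divisors.
by rewrite {1}dE (_ : logn q d = j.+1) //; apply/eqP; rewrite eqn_leq kj1 kj.
Qed.

(** The bound on new divisors is independent of the exponent reached, so one inequality serves all
    [c] steps. *)
Lemma uncoverable_mul_pow (m q c : nat) :
  0 < m -> prime q -> coprime m q -> size (divisors m) < q ->
  uncoverable m -> uncoverable (m * q ^ c).
Proof.
move=> m_gt0 q_pr mq mltq holem.
elim: c => [|c IH]; first by rewrite muln1.
rewrite expnSr mulnA; apply: uncoverable_step => //.
  by rewrite muln_gt0 m_gt0 expn_gt0 prime_gt0.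
exact: leq_ltn_trans (size_new_divisors _ _ _ m_gt0 q_pr mq) mltq.
Qed.

(** Divisors of [m * q] either divide [m] or are new; each kind numbers at most the divisors of
    [m]. *)
Lemma size_divisors_mul_prime (m q : nat) :
  0 < m -> prime q -> coprime m q ->
  size (divisors (m * q)) <= (size (divisors m)).*2.
Proof.
move=> m_gt0 q_pr mq; rewrite -(count_predC (dvdn^~ m)) -addnn leq_add //.
  rewrite -size_filter; apply: uniq_leq_size => [|d].
    by rewrite filter_uniq ?divisors_uniq.
  by rewrite mem_filter -!dvdn_divisors ?muln_gt0 ?m_gt0 ?prime_gt0 // => /andP[].
by rewrite -size_filter; have := @size_new_divisors m q 0 m_gt0 q_pr mq; rewrite muln1.
Qed.

Lemma coprime_primes_lt (p q : nat) : prime p -> prime q -> p < q -> coprime p q.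
Proof. by move=> p_pr q_pr pq; rewrite prime_coprime // dvdn_prime2 // ltn_eqF. Qed.

(** * The numbers excluded by necessity *)

Lemma uncoverable_prime_power (q c : nat) : prime q -> uncoverable (q ^ c).
Proof.
move=> q_pr; rewrite -(mul1n (q ^ c)); apply: uncoverable_mul_pow uncoverable1 => //.
  exact: coprime1n.
exact: prime_gt1.
Qed.

Lemma size_divisors_prime (p : nat) : prime p -> size (divisors p) <= 2.
Proof.
by move=> p_pr; have := @size_divisors_mul_prime 1 p isT p_pr (coprime1n p); rewrite mul1n.
Qed.

Lemma uncoverable_two_primes (p q c : nat) :
  prime p -> prime q -> p < q -> uncoverable (p * q ^ c).
Proof.
move=> p_pr q_pr pq; apply: uncoverable_mul_pow => //.
- exact: prime_gt0.
- exact: coprime_primes_lt.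
- by apply: leq_ltn_trans (size_divisors_prime _ p_pr) (leq_ltn_trans (prime_gt1 p_pr) pq).
- by have := @uncoverable_prime_power p 1 p_pr.
Qed.

Lemma uncoverable_three_primes (p p' q c : nat) :
  prime p -> prime p' -> prime q -> p < p' -> p' < q ->
  uncoverable (p * p' * q ^ c).
Proof.
move=> p_pr p'_pr q_pr pp' p'q.
have p_gt0 := prime_gt0 p_pr; have p'_gt0 := prime_gt0 p'_pr.
(* From [2 <= p < p' < q] one gets only [4 <= q], but 4 is not prime. The bound 4 is needed because
   [p * p'] has four divisors. *)
have q_gt4 : 4 < q.
  have p_gt1 := prime_gt1 p_pr; have : q != 4 by apply: contraTneq q_pr => ->.
  lia.
apply: uncoverable_mul_pow => //.
- by rewrite muln_gt0 p_gt0.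
- by rewrite coprimeMl !coprime_primes_lt // (ltn_trans pp').
- apply: leq_ltn_trans q_gt4.
  apply: leq_trans (size_divisors_mul_prime _ _ p_gt0 p'_pr _) _.
    exact: coprime_primes_lt.
  by rewrite (leq_double _ 2) size_divisors_prime.
- by have := @uncoverable_two_primes p p' 1 p_pr p'_pr pp'.
Qed.

(** * Explicit covers *)

Lemma covering_number_dvd (m n : nat) :
  0 < n -> m %| n -> covering_number m -> covering_number n.
Proof.
move=> n_gt0 mn [_ [s [cov us s1 sm]]]; split => //; exists s; split => // c cs.
exact: dvdn_trans (sm c cs) mn.
Qed.

(** Boolean and with natural representatives, so that concrete covers are checked by computation. *)
Definition covers_period (n : nat) (s : seq (nat * nat)) : bool :=
  all (fun x => has (fun c => x == c.1 %[mod c.2]) s) (iota 0 n).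

(** All moduli divide [n], so an integer lies in every class that contains its remainder modulo
    [n]. *)
Lemma covering_number_of_seq (n : nat) (s : seq (nat * nat)) :
  0 < n -> uniq [seq c.2 | c <- s] -> all (fun c => 1 < c.2) s ->
  all (fun c => c.2 %| n) s -> covers_period n s -> covering_number n.
Proof.
move=> n_gt0 us /allP s1 /allP sn /allP cov; split => //.
exists [seq (Posz c.1, c.2) | c <- s]; split.
- move=> x; have xn : (0 <= (x %% n)%Z)%R by rewrite modz_ge0 //; lia.
  have [k kE] : exists k : nat, (x %% n)%Z = Posz k.
    by exists `|(x %% n)%Z|; rewrite gez0_abs.
  have kn : k < n by rewrite -ltz_nat -kE ltz_pmod.
  have /hasP[c cs kc] : has (fun c => k == c.1 %[mod c.2]) s.
    by apply: cov; rewrite mem_iota.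
  exists (Posz c.1, c.2); first by apply/mapP; exists c.
  apply/residue_classP => /=.
  rewrite (divz_eq x n) kE -addrA rpredD //.
    by rewrite dvdz_mull //; have := sn c cs.
  by rewrite -eqz_mod_dvd !modz_nat.
- by rewrite -map_comp.
- by move=> _ /mapP[c cs ->] /=; apply: s1.
- by move=> _ /mapP[c cs ->] /=; apply: sn.
Qed.

(** Moduli 2, 3, 6 leave 1 mod 6, that is 1 and 7 mod 12, taken by moduli 4 and 12. *)
Lemma covering_number12 : covering_number 12.
Proof.
by apply: (@covering_number_of_seq 12
  [:: (0, 2); (0, 3); (1, 4); (5, 6); (7, 12)]).
Qed.

(** Moduli 2, 3, 6, 9, 18 leave 15 mod 18, that is 15, 33, 51, 69, 87 mod 90, taken in this order by
    moduli 30, 45, 5, 15, 10. *)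
Lemma covering_number90 : covering_number 90.
Proof.
by apply: (@covering_number_of_seq 90
  [:: (0, 2); (2, 3); (1, 5); (1, 6); (3, 9); (7, 10); (9, 15); (9, 18);
      (15, 30); (33, 45)]); vm_compute.
Qed.

(** Moduli 2, 3, 6 leave 2 mod 6, and 5, 10, 15, 30 then leave 14 mod 30. Its seven lifts mod 210
    are taken one each by the seven moduli divisible by 7. *)
Lemma covering_number210 : covering_number 210.
Proof.
by apply: (@covering_number_of_seq 210
  [:: (1, 2); (1, 3); (2, 5); (0, 6); (1, 7); (6, 10); (0, 14); (8, 15);
      (5, 21); (20, 30); (34, 35); (38, 42); (44, 70); (74, 105)]); vm_compute.
Qed.

(** * Completing the first primes to [r] primes *)

Lemma sorted_primes_extend (n : nat) (s : seq nat) :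
  sorted ltn s -> all prime s ->
  exists t : seq nat, [/\ size t = n, sorted ltn (s ++ t) & all prime (s ++ t)].
Proof.
elim: n s => [|n IH] s s_lt s_pr; first by exists [::]; rewrite cats0.
have [p sp p_pr] := prime_above (last 0 s).
have [||t [tn t_lt t_pr]] := IH (rcons s p).
- by case: s s_lt s_pr sp => //= x s s_lt _ sp; rewrite rcons_path s_lt.
- by rewrite all_rcons p_pr.
by exists (p :: t); rewrite -cat_rcons /= tn.
Qed.

Lemma primes_exist (r : nat) (s : seq nat) :
  sorted ltn s -> all prime s -> size s <= r ->
  exists p : r.-tuple nat,
    [/\ forall i : 'I_r, prime (tnth p i),
        forall i j : 'I_r, i < j -> tnth p i < tnth p j
      & take (size s) p = s].
Proof.
move=> s_lt s_pr sr.
have [t [tr t_lt t_pr]] := @sorted_primes_extend (r - size s) s s_lt s_pr.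
have str : size (s ++ t) == r by rewrite size_cat tr subnKC.
exists (Tuple str); split => [i|i j ij|].
- by apply: (allP t_pr); apply: (mem_tnth i (Tuple str)).
- rewrite !(tnth_nth 0); apply: (sorted_ltn_nth ltn_trans) => //;
    by rewrite inE (eqP str) ltn_ord.
- by rewrite /= take_size_cat.
Qed.

Lemma prod_take_dvd (r k : nat) (p alpha : r.-tuple nat) :
  k <= r ->
  \prod_(0 <= i < k) nth 0 (take k p) i ^ nth 0 alpha i
    %| \prod_(i < r) tnth p i ^ tnth alpha i.
Proof.
move=> kr; under [X in _ %| X]eq_bigr do rewrite !(tnth_nth 0).
rewrite -(big_mkord xpredT (fun i => nth 0 p i ^ nth 0 alpha i)).
rewrite (big_cat_nat (leq0n k) kr) //= dvdn_mulr // big_nat_cond [X in _ %| X]big_nat_cond.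
rewrite (eq_bigr (fun i => nth 0 p i ^ nth 0 alpha i)) // => i /andP[/andP[_ ik] _].
by rewrite nth_take.
Qed.

(** Larger primes appended to [s] only multiply the product, which remains a multiple of [n].
    Indexing by naturals lets the product over a concrete [s] unfold. *)
Lemma covering_of_primes (r : nat) (alpha : r.-tuple nat) (s : seq nat) (n : nat) :
  sorted ltn s -> all prime s -> size s <= r -> covering_number n ->
  n %| \prod_(0 <= i < size s) nth 0 s i ^ nth 0 alpha i ->
  exists p : r.-tuple nat,
    [/\ forall i : 'I_r, prime (tnth p i),
        forall i j : 'I_r, i < j -> tnth p i < tnth p j
      & covering_number (\prod_(i < r) tnth p i ^ tnth alpha i)].
Proof.
move=> s_lt s_pr sr covn n_dvd; have [p [p_pr p_lt ps]] := @primes_exist r s s_lt s_pr sr.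
exists p; split => //; apply: covering_number_dvd covn.
  by apply: prodn_gt0 => i; rewrite expn_gt0 prime_gt0.
by apply: dvdn_trans n_dvd _; rewrite -{2}ps prod_take_dvd.
Qed.

(** * The equivalence, by cases on [r] *)

Theorem theorem1p2 (r : nat) (alpha : r.-tuple nat)
  (hr : 0 < r) (halpha : forall i : 'I_r, 0 < tnth alpha i) :
  (exists p : r.-tuple nat,
      [/\ forall i : 'I_r, prime (tnth p i),
          forall i j : 'I_r, i < j -> tnth p i < tnth p j
        & covering_number (\prod_(i < r) tnth p i ^ tnth alpha i)])
  <->
  [\/ r = 2 /\ 2 <= nth 0 alpha 0,
      r = 3 /\ 2 <= maxn (nth 0 alpha 0) (nth 0 alpha 1)
    | 4 <= r].
Proof.
have alpha_gt0 i : i < r -> 0 < nth 0 alpha i.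
  by move=> ir; have := halpha (Ordinal ir); rewrite (tnth_nth 0).
split.
  case=> p [p_pr p_lt].
  under eq_bigr do rewrite !(tnth_nth 0).
  have pr i : i < r -> prime (nth 0 p i).
    by move=> ir; have := p_pr (Ordinal ir); rewrite (tnth_nth 0).
  have lt i : i.+1 < r -> nth 0 p i < nth 0 p i.+1.
    move=> ir; have := p_lt (Ordinal (ltnW ir)) (Ordinal ir) (ltnSn i).
    by rewrite !(tnth_nth 0).
  move=> cov; have [r4|r4] := leqP 4 r; first by constructor 3.
  have [r2|r2 |r2] := ltngtP r 2.
  - have r1 : r = 1 by lia.
    subst r; move: cov; rewrite big_ord_recl big_ord0 muln1 /=.
    by move/uncoverable_not_covering: (uncoverable_prime_power _ (nth 0 alpha 0) (pr 0 isT)).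
  - have r3 : r = 3 by lia.
    (* Otherwise positivity forces the first two exponents to be 1, which gives the form
       [p * p' * q ^ c]. *)
    subst r; constructor 2; split => //; rewrite leqNgt; apply/negP => a1.
    have [a0E a1E] : nth 0 alpha 0 = 1 /\ nth 0 alpha 1 = 1.
      by have := alpha_gt0 0 isT; have := alpha_gt0 1 isT; lia.
    move: cov; rewrite !big_ord_recl big_ord0 muln1 /= a0E a1E !expn1 mulnA.
    exact/uncoverable_not_covering/uncoverable_three_primes/lt/isT/lt/isT/pr/isT/pr/isT/pr.
  - subst r; constructor 1; split => //; rewrite leqNgt; apply/negP => a1.
    have a0E : nth 0 alpha 0 = 1 by have := alpha_gt0 0 isT; lia.
    move: cov; rewrite !big_ord_recl big_ord0 muln1 /= a0E expn1.
    apply: uncoverable_not_covering; apply: uncoverable_two_primes; last exact: lt.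
    + exact: pr.
    + exact: pr.
case=> [[r2 a0]|[r3]|r4].
- apply: (@covering_of_primes r alpha [:: 2; 3] _ isT isT _ covering_number12).
    by rewrite r2.
  rewrite unlock /= muln1 (@dvdn_mul (2 ^ 2) 3) ?dvdn_exp2l //.
  by rewrite dvdn_exp // alpha_gt0 // r2.
- rewrite leq_max => /orP[a0|a1].
    apply: (@covering_of_primes r alpha [:: 2; 3] _ isT isT _ covering_number12).
      by rewrite r3.
    rewrite unlock /= muln1 (@dvdn_mul (2 ^ 2) 3) ?dvdn_exp2l //.
    by rewrite dvdn_exp // alpha_gt0 // r3.
  (* The exponent of 2 may be 1 here; the square comes from 3, as in 90. *)
  apply: (@covering_of_primes r alpha [:: 2; 3; 5] _ isT isT _ covering_number90).
    by rewrite r3.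
  rewrite unlock /= muln1; apply: (@dvdn_mul 2 45).
    by rewrite dvdn_exp // alpha_gt0 // r3.
  by rewrite (@dvdn_mul (3 ^ 2) 5) ?dvdn_exp2l // dvdn_exp // alpha_gt0 // r3.
- apply: (@covering_of_primes r alpha [:: 2; 3; 5; 7] _ isT isT r4 covering_number210).
  rewrite unlock /= muln1; apply: (@dvdn_mul 2 105); last apply: (@dvdn_mul 3 35).
  3: apply: (@dvdn_mul 5 7).
  all: by rewrite dvdn_exp // alpha_gt0 //; lia.
Qed.
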